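(* Let $\nu,\mu\in\mathbb R$, let $\lambda$ be a constant and $\lambda^{*}_{\nu-\mu}=\lambda-\kappa_{2\nu-2\mu-1}$. The adjoint difference equation $$\sigma(z+1)\frac{\Delta}{\Delta x_{\nu-\mu-1}(z)}\Big(\frac{\nabla y(z)}{\nabla x_{\nu-\mu}(z)}\Big)-\tau_{\nu-\mu-2}(z+1)\frac{\nabla y(z)}{\nabla x_{\nu-\mu}(z)}+\lambda^{*}_{\nu-\mu}y(z)=0$$ has particular solutions of the form $$y(z)=\sum_{s=a}^{b-1}\frac{\rho_\nu(s)\nabla x_{\nu+1}(s)}{[x_\nu(s)-x_\nu(z)]^{(\mu+1)}}$$ and also of the form $$y(z)=\oint_C\frac{\rho_\nu(s)\nabla x_{\nu+1}(s)\,ds}{[x_\nu(s)-x_\nu(z)]^{(\mu+1)}},$$ where $a,b$ are complex numbers with the same imaginary part and $b-a\in\mathbb N$, and $C$ is a contour in the complex $s$-plane, provided that: (i) functions $\rho(z)$ and $\rho_\nu(z)$ satisfy $\frac{\Delta}{\nabla x_1(z)}[\sigma(z)\rho(z)]=\tau(z)\rho(z)$ and $\frac{\Delta}{\nabla x_{\nu+1}(z)}[\sigma(z)\rho_\nu(z)]=\tau_\nu(z)\rho_\nu(z)$; (ii) $\mu,\nu$ satisfy $\lambda^{*}_{\nu-\mu}+\kappa_{2\nu-(\mu+1)}\gamma(\mu+1)=0$; (iii) the difference derivatives of the functions $$\phi_{\nu m}(z)=\sum_{s=a}^{b-1}\frac{\rho_\nu(s)\nabla x_{\nu+1}(s)}{[x_\nu(s)-x_\nu(z)]^{(m+1)}}\quad\text{or,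 respectively,}\quad \phi_{\nu m}(z)=\oint_C\frac{\rho_\nu(s)\nabla x_{\nu+1}(s)\,ds}{[x_\nu(s)-x_\nu(z)]^{(m+1)}}$$ can be calculated by the formula $\frac{\nabla\phi_{\nu m}(z)}{\nabla x_{\nu-m}(z)}=\gamma(m+1)\phi_{\nu,m+1}(z)$ for $m=\mu$ and $m=\mu+1$; (iv) with $$\psi_{\nu\mu}(s,z)=\frac{\sigma(s)\rho_\nu(s)}{[x_{\nu-1}(s)-x_{\nu-1}(z+1)]^{(\mu+2)}},$$ one has $\psi_{\nu\mu}(a,z)=\psi_{\nu\mu}(b,z)$ (for the sum), respectively $\oint_C\Delta_s\psi_{\nu\mu}(s,z)\,ds=0$ (for the integral).
   Context: Lattice and differences. $x(s)$, $s\in\mathbb C$, is a non-uniform lattice: either $x(s)=c_1q^s+c_2q^{-s}+c_3$ with $c_1c_2\ne0$ ($q\neq0,1$ fixed, with a fixed value of $\log q$ and $q^s=e^{s\log q}$), or $x(s)=\tilde c_1s^2+\tilde c_2s+\tilde c_3$ with $\tilde c_1\tilde c_2\neq0$. For real $\eta$, $x_\eta(s)=x(s+\frac{\eta}{2})$. $\Delta f(s)=f(s+1)-f(s)$, $\nabla f(s)=f(s)-f(s-1)$; a subscript $s$ as in $\Delta_s$ means the difference is taken in $s$. All expressions are considered where the denominators do not vanish. Sums $\sum_{s=a}^{b-1}$ run over $s=a,a+1,\dots,b-1$. Coefficients. $\tilde\sigma[x]$ and $\tilde\tau[x]$ are polynomials in $x$ of degrees at most two and one; $\tau(z)=\tilde\tau[x(z)]$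 and $\sigma(z)=\tilde\sigma[x(z)]-\frac12\tilde\tau[x(z)]\nabla x_1(z)$. For real $\eta$, $\tau_\eta$ is defined by $\tau_\eta(z)\nabla x_{\eta+1}(z)=\sigma(z+\eta)-\sigma(z)+\tau(z+\eta)\nabla x_1(z+\eta)$. Put $\alpha(\eta)=\frac{q^{\eta/2}+q^{-\eta/2}}2$, $\gamma(\eta)=\frac{q^{\eta/2}-q^{-\eta/2}}{q^{1/2}-q^{-1/2}}$ in the $q$-case and $\alpha(\eta)=1$, $\gamma(\eta)=\eta$ in the quadratic case, and $\kappa_\eta=\alpha(\eta-1)\tilde\tau'+\frac12\gamma(\eta-1)\tilde\sigma''$ (derivatives with respect to $x$), so that $\tau_\eta(z)-\kappa_{2\eta+1}x_\eta(z)$ is constant in $z$. The displayed equation is the adjoint of $\sigma(z)\frac{\Delta}{\Delta x_{\nu-\mu-1}(z)}\big(\frac{\nabla y(z)}{\nabla x_{\nu-\mu}(z)}\big)+\tau_{\nu-\mu}(z)\frac{\Delta y(z)}{\Delta x_{\nu-\mu}(z)}+\lambda y(z)=0$. Generalized powers. $[x_\eta(s)-x_\eta(z)]^{(m)}$ ($\eta,m$ real) denotes Suslov's generalized power: a fixed family of functions of $(s,z)$ with $[x_\eta(s)-x_\eta(z)]^{(0)}=1$ and, for all real $\eta,m$, $$[x_\eta(s)-x_\eta(z)]\,[x_\eta(s)-x_\eta(z-1)]^{(m)}=[x_\eta(s)-x_\eta(z)]^{(m)}\,[x_\eta(s)-x_\eta(z-m)]=[x_\eta(s)-x_\eta(z)]^{(m+1)},$$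 $$[x_{\eta-1}(s+1)-x_{\eta-1}(z)]^{(m)}[x_{\eta-m}(s)-x_{\eta-m}(z)]=[x_{\eta-m}(s+m)-x_{\eta-m}(z)][x_{\eta-1}(s)-x_{\eta-1}(z)]^{(m)}=[x_\eta(s)-x_\eta(z)]^{(m+1)}.$$ For a nonnegative integer $m$ it equals $\prod_{j=0}^{m-1}[x_\eta(s)-x_\eta(z-j)]$; for $x(z)=z^2$ it is $\frac{\Gamma(s-z+m)\Gamma(s+z+\eta+1)}{\Gamma(s-z)\Gamma(s+z+\eta-m+1)}$. *)

(* Defs.v *)
From Stdlib Require Import Reals.
From Coquelicot Require Import Coquelicot.
Open Scope C_scope.

(* Inverses of 0 are junk values: every use of the quotients below is guarded
   by an explicit nonvanishing hypothesis. *)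

Definition Cexp (z : C) : C :=
  ((exp (fst z) * cos (snd z))%R, (exp (fst z) * sin (snd z))%R).

Fixpoint csum (f : nat -> C) (n : nat) : C :=
  match n with O => 0 | S k => csum f k + f k end.

Fixpoint cprod (f : nat -> C) (n : nat) : C :=
  match n with O => 1 | S k => cprod f k * f k end.

Definition delta (f : C -> C) (s : C) : C := f (s + 1) - f s.
Definition nabla (f : C -> C) (s : C) : C := f s - f (s - 1).

(* [qlat logq c1 c2 c3] is c1 q^s + c2 q^(-s) + c3 with q = Cexp logq, which is
   never 0; the parameter is the chosen value of log q, since non-integer
   powers of q depend on it.
   [quadlat c1 c2 c3] is c1 s^2 + c2 s + c3. *)
Inductive lattice : Type :=
| qlat (logq c1 c2 c3 : C)
| quadlat (c1 c2 c3 : C).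

Definition lattice_ok (L : lattice) : Prop :=
  match L with
  | qlat logq c1 c2 _ => Cexp logq <> 1 /\ c1 * c2 <> 0
  | quadlat c1 c2 _ => c1 * c2 <> 0
  end.

Definition qpow (logq s : C) : C := Cexp (s * logq).

Definition lat_x (L : lattice) (s : C) : C :=
  match L with
  | qlat logq c1 c2 c3 => c1 * qpow logq s + c2 * qpow logq (- s) + c3
  | quadlat c1 c2 c3 => c1 * (s * s) + c2 * s + c3
  end.

Definition xs (L : lattice) (eta : R) (s : C) : C := lat_x L (s + RtoC (eta / 2)).

Definition alpha (L : lattice) (eta : R) : C :=
  match L with
  | qlat h _ _ _ => (qpow h (RtoC (eta / 2)) + qpow h (RtoC (- eta / 2))) / 2
  | quadlat _ _ _ => 1
  end.

Definition gamma (L : lattice) (eta : R) : C :=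
  match L with
  | qlat h _ _ _ =>
      (qpow h (RtoC (eta / 2)) - qpow h (RtoC (- eta / 2)))
      / (qpow h (RtoC (1 / 2)) - qpow h (RtoC (- 1 / 2)))
  | quadlat _ _ _ => RtoC eta
  end.

Record hdata : Type := HData {
  lat : lattice;
  sg2 : C; sg1 : C; sg0 : C;
  tu1 : C; tu0 : C
}.

Definition sigma_tilde (d : hdata) (u : C) : C :=
  sg2 d * (u * u) + sg1 d * u + sg0 d.
Definition tau_tilde (d : hdata) (u : C) : C := tu1 d * u + tu0 d.
(* sigma_tilde'' and tau_tilde', which are constant *)
Definition sigma_tilde'' (d : hdata) : C := 2 * sg2 d.
Definition tau_tilde' (d : hdata) : C := tu1 d.

Definition tau_s (d : hdata) (z : C) : C := tau_tilde d (lat_x (lat d) z).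

Definition sigma_s (d : hdata) (z : C) : C :=
  sigma_tilde d (lat_x (lat d) z)
  - / 2 * tau_tilde d (lat_x (lat d) z) * nabla (xs (lat d) 1) z.

Definition tau_eta (d : hdata) (eta : R) (z : C) : C :=
  (sigma_s d (z + RtoC eta) - sigma_s d z
   + tau_s d (z + RtoC eta) * nabla (xs (lat d) 1) (z + RtoC eta))
  / nabla (xs (lat d) (eta + 1)) z.

Definition kappa (d : hdata) (eta : R) : C :=
  alpha (lat d) (eta - 1) * tau_tilde' d
  + / 2 * gamma (lat d) (eta - 1) * sigma_tilde'' d.

(* [gp P eta m s z] is [x_eta(s) - x_eta(z)]^(m), and [gp_dom P eta m] is the
   set of (s,z) at which it is defined.  A domain is unavoidable: for negative
   or non-integer m these functions have poles (e.g. the power -1 at s = z + 1,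
   where the recurrence would read 0 = 1), so no family of everywhere defined
   functions satisfies the identities. *)
Record genpow (L : lattice) : Type := GenPow {
  gp : R -> R -> C -> C -> C;
  gp_dom : R -> R -> C -> C -> Prop;
  gp_nat : forall (eta : R) (n : nat) (s z : C),
    gp_dom eta (INR n) s z /\
    gp eta (INR n) s z
    = cprod (fun j => xs L eta s - xs L eta (z - RtoC (INR j))) n;
  gp_head : forall (eta m : R) (s z : C),
    gp_dom eta m s (z - 1) -> gp_dom eta (m + 1) s z ->
    (xs L eta s - xs L eta z) * gp eta m s (z - 1) = gp eta (m + 1) s z;
  gp_last : forall (eta m : R) (s z : C),
    gp_dom eta m s z -> gp_dom eta (m + 1) s z ->
    gp eta m s z * (xs L eta s - xs L eta (z - RtoC m)) = gp eta (m + 1) s z;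
  gp_shift_succ : forall (eta m : R) (s z : C),
    gp_dom (eta - 1) m (s + 1) z -> gp_dom eta (m + 1) s z ->
    gp (eta - 1) m (s + 1) z * (xs L (eta - m) s - xs L (eta - m) z)
    = gp eta (m + 1) s z;
  gp_shift : forall (eta m : R) (s z : C),
    gp_dom (eta - 1) m s z -> gp_dom eta (m + 1) s z ->
    (xs L (eta - m) (s + RtoC m) - xs L (eta - m) z) * gp (eta - 1) m s z
    = gp eta (m + 1) s z
}.
Arguments gp {L} _ _ _ _ _.
Arguments gp_dom {L} _ _ _ _ _.

Definition gp_ok {L : lattice} (P : genpow L) (eta m : R) (s z : C) : Prop :=
  gp_dom P eta m s z /\ gp P eta m s z <> 0.

Definition kernel {L : lattice} (P : genpow L) (rho_nu : C -> C)
    (nu m : R) (z s : C) : C :=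
  rho_nu s * nabla (xs L (nu + 1)) s / gp P nu (m + 1) s z.

Definition psi (d : hdata) (P : genpow (lat d)) (rho_nu : C -> C)
    (nu mu : R) (s z : C) : C :=
  sigma_s d s * rho_nu s / gp P (nu - 1) (mu + 2) s (z + 1).

(* [pts] is the set of s over which one sums or integrates *)
Definition kernel_ok {L : lattice} (P : genpow L) (nu m : R)
    (pts : C -> Prop) (z : C) : Prop :=
  forall s, pts s -> gp_ok P nu (m + 1) s z.

Definition psi_ok {L : lattice} (P : genpow L) (nu mu : R)
    (pts : C -> Prop) (z : C) : Prop :=
  forall s, pts s ->
    gp_ok P (nu - 1) (mu + 2) s (z + 1) /\
    gp_ok P (nu - 1) (mu + 2) (s + 1) (z + 1).

Definition sum_pts (a : C) (N : nat) (s : C) : Prop :=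
  exists k : nat, (k < N)%nat /\ s = a + RtoC (INR k).

Definition phi_sum {L : lattice} (P : genpow L) (rho_nu : C -> C) (nu : R)
    (a : C) (N : nat) (m : R) (z : C) : C :=
  csum (fun k => kernel P rho_nu nu m z (a + RtoC (INR k))) N.

Definition phi_sum_ok {L : lattice} (P : genpow L) (nu : R)
    (a : C) (N : nat) (m : R) (z : C) : Prop :=
  kernel_ok P nu m (sum_pts a N) z.

(* A C^1 function on a compact interval is the restriction of a C^1 function
   on the line. *)
Definition C1_on (c : R -> C) (ta tb : R) : Prop :=
  exists g dg : R -> C,
    (forall t : R,
       is_derive (K := R_AbsRing) (V := C_R_NormedModule) g t (dg t) /\
       continuous (T := R_UniformSpace) (U := C_UniformSpace) dg t) /\
    (forall t : R, (ta <= t <= tb)%R -> c t = g t).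

(* A contour is a piecewise C^1 path on [ta, tb]; it need not be closed. *)
Inductive contour (c : R -> C) : R -> R -> Prop :=
| contour_arc (ta tb : R) : (ta < tb)%R -> C1_on c ta tb -> contour c ta tb
| contour_cat (ta tm tb : R) :
    contour c ta tm -> contour c tm tb -> contour c ta tb.

Definition contour_pts (c : R -> C) (ta tb : R) (s : C) : Prop :=
  exists t : R, (ta <= t <= tb)%R /\ s = c t.

(* junk at the finitely many break points, which does not affect integrals *)
Definition path_derive (c : R -> C) (t : R) : C :=
  (Derive (fun u => fst (c u)) t, Derive (fun u => snd (c u)) t).

Definition cint (c : R -> C) (ta tb : R) (f : C -> C) : C :=
  RInt (V := C_R_CompleteNormedModule)
    (fun t => f (c t) * path_derive c t) ta tb.

Definition ex_cint (c : R -> C) (ta tb : R) (f : C -> C) : Prop :=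
  ex_RInt (V := C_R_NormedModule)
    (fun t => f (c t) * path_derive c t) ta tb.

Definition phi_int {L : lattice} (P : genpow L) (rho_nu : C -> C) (nu : R)
    (c : R -> C) (ta tb : R) (m : R) (z : C) : C :=
  cint c ta tb (kernel P rho_nu nu m z).

Definition phi_int_ok {L : lattice} (P : genpow L) (rho_nu : C -> C) (nu : R)
    (c : R -> C) (ta tb : R) (m : R) (z : C) : Prop :=
  kernel_ok P nu m (contour_pts c ta tb) z /\
  ex_cint c ta tb (kernel P rho_nu nu m z).

(* In the next three definitions [phi m z] is phi_{nu m}(z) and [ok m z] says
   that it is well defined. *)
Definition diff_formula_ok (L : lattice) (nu : R) (ok : R -> C -> Prop)
    (m : R) (z : C) : Prop :=
  nabla (xs L (nu - m)) z <> 0 /\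
  ok m z /\ ok m (z - 1) /\ ok (m + 1)%R z.

Definition diff_formula (L : lattice) (nu : R) (phi : R -> C -> C)
    (m : R) (z : C) : Prop :=
  nabla (phi m) z / nabla (xs L (nu - m)) z
  = gamma L (m + 1) * phi (m + 1)%R z.

(* z is a point at which all the expressions of the adjoint equation, of the
   difference formulas used for it and of Delta_s psi are well defined; note
   that Delta x_{nu-mu-1}(z) = nabla x_{nu-mu-1}(z+1). *)
Definition admissible {L : lattice} (P : genpow L) (nu mu : R)
    (pts : C -> Prop) (ok : R -> C -> Prop) (z : C) : Prop :=
  diff_formula_ok L nu ok mu z /\
  diff_formula_ok L nu ok mu (z + 1) /\
  diff_formula_ok L nu ok (mu + 1) (z + 1) /\
  psi_ok P nu mu pts z.

Definition lambda_star (d : hdata) (nu mu : R) (lambda : C) : C :=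
  lambda - kappa d (2 * nu - 2 * mu - 1).

Definition adjoint_eq (d : hdata) (nu mu : R) (lambda : C)
    (y : C -> C) (z : C) : Prop :=
  sigma_s d (z + 1)
  * (delta (fun w => nabla y w / nabla (xs (lat d) (nu - mu)) w) z
     / delta (xs (lat d) (nu - mu - 1)) z)
  - tau_eta d (nu - mu - 2) (z + 1)
    * (nabla y z / nabla (xs (lat d) (nu - mu)) z)
  + lambda_star d nu mu lambda * y z = 0.

(* Main.v *)
Require Import Defs.
From Stdlib Require Import Reals Lra.
From Coquelicot Require Import Coquelicot.
Open Scope C_scope.

(** Write K_m(z,s) for the kernel of phi_{nu m}, so that phi_{nu m}(z) is the sum
    or the contour integral of K_m(z,s) over s.

    The difference formulas turn the adjoint equation into an equation without
    differences.  With y = phi_{nu mu}, the first difference quotient of y at z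
    and at z+1 is gamma(mu+1) phi_{nu,mu+1}, and one more application at z+1
    turns the second one into gamma(mu+1) gamma(mu+2) phi_{nu,mu+2}(z+1).
    The condition on mu and nu writes lambda* as
    - kappa_{2nu-mu-1} gamma(mu+1), so the left side of the equation is gamma(mu+1) times

      sigma(z+1) gamma(mu+2) phi_{nu,mu+2}(z+1)
        - tau_{nu-mu-2}(z+1) phi_{nu,mu+1}(z) - kappa_{2nu-mu-1} phi_{nu,mu}(z)

    ([adjoint_eq_of_combination]).  The same combination of the kernels
    K_{mu+2}(z+1,s), K_{mu+1}(z,s), K_mu(z,s) equals - Delta_s psi(s,z) for every
    s ([delta_psi_kernel]).  Hence the sum telescopes to psi(a,z) - psi(b,z) and
    the integral is - oint Delta_s psi, both zero by the boundary condition on psi.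

    For the kernel identity, the rules for generalized powers bring all five
    powers to the common denominator [x_nu(s) - x_nu(z+1)]^(mu+3), and the
    Pearson equation replaces sigma(s+1) rho_nu(s+1) by rho_nu(s) times
    sigma(s+nu) + tau(s+nu) nabla x_1(s+nu).  After division by rho_nu(s) there
    remains an identity on the lattice alone, [lattice_identity]: two expressions
    of degree at most two in x_nu(s) agree, because they agree at two nodes and have the
    same leading coefficient. *)

(** * Complex arithmetic *)

(* Equality of two complex numbers that are affine in complex variables with
   coefficients computed in R, such as the arguments of the lattice. *)
Ltac C_affine :=
  apply injective_projections; cbn; try lra; try field.

Lemma RtoC_2 : RtoC 2 = 1 + 1.
Proof. C_affine. Qed.

Lemma C2_neq_0 : (1 + 1 : C) <> 0.
Proof. intro E; apply (f_equal fst) in E; cbn in E; lra. Qed.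

Lemma Cmult_cancel_l (u v w : C) : u <> 0 -> u * v = u * w -> v = w.
Proof.
intros hu E; replace v with (/ u * (u * v)) by (field; exact hu).
rewrite E; field; exact hu.
Qed.

Lemma Cdiv_expand (x u v w : C) : u * v = w -> w <> 0 -> x / u = x * v / w.
Proof.
intros E hw; rewrite <- E in hw |- *; field.
split; intro F; apply hw; rewrite F; ring.
Qed.

Lemma Cexp_plus (u v : C) : Cexp (u + v) = Cexp u * Cexp v.
Proof.
unfold Cexp; destruct u as [a b], v as [a' b']; cbn.
rewrite exp_plus, cos_plus, sin_plus; C_affine; ring.
Qed.

Lemma Cexp_0 : Cexp 0 = 1.
Proof. unfold Cexp; cbn; rewrite exp_0, cos_0, sin_0; C_affine. Qed.

Lemma qpow_plus (h u v : C) : qpow h (u + v) = qpow h u * qpow h v.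
Proof. unfold qpow; rewrite <- Cexp_plus; f_equal; ring. Qed.

Lemma qpow_mul_opp (h u : C) : qpow h u * qpow h (- u) = 1.
Proof.
rewrite <- qpow_plus, <- Cexp_0; unfold qpow; f_equal; ring.
Qed.

Lemma qpow_neq_0 (h u : C) : qpow h u <> 0.
Proof.
intro E; generalize (qpow_mul_opp h u); rewrite E, Cmult_0_l.
intro F; apply (f_equal fst) in F; cbn in F; lra.
Qed.

Lemma qpow_opp (h u : C) : qpow h (- u) = / qpow h u.
Proof.
apply (Cmult_cancel_l (qpow h u)); [apply qpow_neq_0|].
rewrite qpow_mul_opp, Cinv_r; [reflexivity | apply qpow_neq_0].
Qed.

Lemma qpow_1 (h : C) : qpow h 1 = Cexp h.
Proof. unfold qpow; f_equal; ring. Qed.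

Lemma qpow_half_sqr (h : C) : qpow h 1 = qpow h (RtoC (1 / 2)) * qpow h (RtoC (1 / 2)).
Proof. rewrite <- qpow_plus; f_equal; C_affine. Qed.

(** * The lattice identity *)

(** This is sigma-tilde + tau-tilde nabla x_1 / 2, whereas [sigma_s] has the
    opposite sign.  The reflection of the s-plane that preserves the lattice
    changes the sign of nabla x_1, so it exchanges the two functions. *)
Definition sigma_plus (d : hdata) (u : C) : C :=
  sigma_s d u + tau_s d u * nabla (xs (lat d) 1) u.

(** In the application p = s + nu/2, r = z + (nu-mu)/2, k = mu/2 + 1, n = nu/2,
    which centres every lattice point at p or r.  As a function of p, both sides
    are odd under the reflection that preserves x.  So is dx, and the
    quotients by dx p are polynomials of degree at most two in x p.  These have the same
    coefficient of (x p)^2, namely the one with kappa, and the same values at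
    p = r + k and p = r - k, because
    x (u + k) - x (u - k) = gamma (2 k) dx u.  The difference
    sigma_plus (r - k + n) - sigma_s (r + k - n) stands for the numerator of
    tau_{nu-mu-2}(z+1), whose denominator is dx r.  In terms of the powers of q
    with exponents p, r, k, n and 1/2, or of p, r, k, n themselves on a quadratic
    lattice, it is an identity of rational functions. *)
Lemma lattice_identity (d : hdata) (hL : lattice_ok (lat d)) (p r : C) (k n : R) :
  let x := lat_x (lat d) in
  let dx := nabla (xs (lat d) 1) in
  dx p * (dx r * (sigma_s d (r + k - n) * gamma (lat d) (2 * k))
          - (sigma_plus d (r - k + n) - sigma_s d (r + k - n)) * (x p - x (r + k))
          - dx r * kappa d (4 * n - 2 * k + 1) * (x p - x (r + k)) * (x p - x (r - k)))
  = - (dx r * (sigma_plus d (p + n) * (x (p - k) - x r)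
               - sigma_s d (p - n) * (x (p + k) - x r))).
Proof.
destruct d as [L s2 s1 s0 t1 t0].
destruct L as [h c1 c2 c3|c1 c2 c3]; cbn in hL;
  cbv [sigma_plus sigma_s tau_s sigma_tilde tau_tilde sigma_tilde'' tau_tilde'
       kappa alpha gamma lat_x xs nabla lat sg2 sg1 sg0 tu1 tu0].
- destruct hL as [hq _].
  replace (2 * k / 2)%R with k by field.
  replace (- (2 * k) / 2)%R with (- k)%R by field.
  replace ((4 * n - 2 * k + 1 - 1) / 2)%R with (n + n - k)%R by field.
  replace (- (4 * n - 2 * k + 1 - 1) / 2)%R with (- (n + n - k))%R by field.
  replace (- 1 / 2)%R with (- (1 / 2))%R by field.
  unfold Rminus, Cminus.
  repeat rewrite ?RtoC_plus, ?RtoC_opp, ?qpow_plus, ?qpow_opp.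
  rewrite <- qpow_1 in hq. rewrite qpow_half_sqr in *.
  generalize (qpow_neq_0 h p) (qpow_neq_0 h r) (qpow_neq_0 h k)
    (qpow_neq_0 h n) (qpow_neq_0 h (RtoC (1 / 2))).
  revert hq.
  generalize (qpow h p) (qpow h r) (qpow h k) (qpow h n) (qpow h (RtoC (1 / 2))).
  intros P R K N H hq hP hR hK hN hH.
  rewrite !RtoC_2; field; repeat split; auto using C2_neq_0.
  (* The only denominator left is q - 1 with q = H * H. *)
  intro E; apply hq.
  replace (H * H) with (H * H + RtoC (-1) + 1) by C_affine.
  rewrite E; ring.
- rewrite !Rdiv_def, !RtoC_mult.
  unfold Rminus. rewrite !RtoC_plus, !RtoC_opp, !RtoC_mult.
  replace (RtoC 4) with ((1 + 1) * (1 + 1)) by C_affine.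
  rewrite (RtoC_inv 2), !RtoC_2 by lra.
  field; auto using C2_neq_0.
Qed.

(** * The kernels and the boundary function *)

Lemma nabla_xs_succ (L : lattice) (eta : R) (s : C) :
  nabla (xs L (eta + 1)) s = nabla (xs L 1) (s + RtoC (eta / 2)).
Proof. unfold nabla, xs; apply f_equal2; f_equal; C_affine. Qed.

Lemma tau_eta_mul (d : hdata) (eta : R) (z : C) :
  nabla (xs (lat d) (eta + 1)) z <> 0 ->
  tau_eta d eta z * nabla (xs (lat d) (eta + 1)) z
  = sigma_plus d (z + RtoC eta) - sigma_s d z.
Proof. intro h; unfold tau_eta, sigma_plus; field; exact h. Qed.

(** The summand is an exact difference in s.  With the power
    W = [x_nu(s) - x_nu(z+1)]^(mu+3) as common denominator, the two shift rules
    produce the factors x(p + k) - x(r) and x(p - k) - x(r) of psi(s,z) and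
    psi(s+1,z), while the rules at the first and the last factor produce
    x(p) - x(r + k) and x(p) - x(r - k) of the kernels; the numerators then match
    by [lattice_identity]. *)
Lemma delta_psi_kernel (d : hdata) (hL : lattice_ok (lat d)) (P : genpow (lat d))
    (rho_nu : C -> C) (nu mu : R) (z s : C) :
  nabla (xs (lat d) (nu - (mu + 1))) (z + 1) <> 0 ->
  nabla (xs (lat d) (nu + 1)) s <> 0 ->
  delta (fun w => sigma_s d w * rho_nu w) s / nabla (xs (lat d) (nu + 1)) s
    = tau_eta d nu s * rho_nu s ->
  gp_ok P nu (mu + 1) s z ->
  gp_ok P nu (mu + 1 + 1) s z ->
  gp_ok P nu (mu + 1 + 1 + 1) s (z + 1) ->
  gp_ok P (nu - 1) (mu + 2) s (z + 1) ->
  gp_ok P (nu - 1) (mu + 2) (s + 1) (z + 1) ->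
  delta (fun w => psi d P rho_nu nu mu w z) s
  = - (sigma_s d (z + 1) * gamma (lat d) (mu + 1 + 1))
      * kernel P rho_nu nu (mu + 1 + 1) (z + 1) s
    + tau_eta d (nu - mu - 2) (z + 1) * kernel P rho_nu nu (mu + 1) z s
    + kappa d (2 * nu - (mu + 1)) * kernel P rho_nu nu mu z s.
Proof.
intros hY hX hpearson [dE _] [dG nG] [dW nW] [dV _] [dV' _].
(* The substitution that turns all shifted lattices into x around p and r. *)
set (p := s + RtoC (nu / 2)); set (r := z + RtoC (nu / 2 - mu / 2)).
set (k := (mu / 2 + 1)%R); set (n := (nu / 2)%R).
generalize (lattice_identity d hL p r k n); cbv zeta; intro core.
pose proof (gp_last _ P nu (mu + 1) s z dE dG) as eG.
assert (dG' : gp_dom P nu (mu + 1 + 1) s (z + 1 - 1))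
  by (replace (z + 1 - 1) with z by ring; exact dG).
pose proof (gp_head _ P nu (mu + 1 + 1) s (z + 1) dG' dW) as eW.
replace (z + 1 - 1) with z in eW by ring.
replace (mu + 1 + 1 + 1)%R with (mu + 2 + 1)%R in dW, nW, eW by ring.
pose proof (gp_shift _ P nu (mu + 2) s (z + 1) dV dW) as eV.
pose proof (gp_shift_succ _ P nu (mu + 2) s (z + 1) dV' dW) as eV'.
unfold kernel.
replace (mu + 1 + 1 + 1)%R with (mu + 2 + 1)%R by ring.
replace (nu - (mu + 1))%R with (nu - mu - 2 + 1)%R in hY by ring.
pose proof (tau_eta_mul d (nu - mu - 2) (z + 1) hY) as eT.
pose proof (tau_eta_mul d nu s hX) as eS.
(* The Pearson equation for rho_nu, solved for the value at s + 1. *)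
assert (pearson : sigma_s d (s + 1) * rho_nu (s + 1)
                  = rho_nu s * sigma_plus d (s + RtoC nu)).
{ unfold delta in hpearson.
  apply (f_equal (fun w => w * nabla (xs (lat d) (nu + 1)) s)) in hpearson.
  unfold Cdiv in hpearson.
  rewrite <- Cmult_assoc, Cinv_l, Cmult_1_r in hpearson by exact hX.
  replace (sigma_s d (s + 1) * rho_nu (s + 1))
    with (sigma_s d (s + 1) * rho_nu (s + 1) - sigma_s d s * rho_nu s
          + sigma_s d s * rho_nu s) by ring.
  rewrite hpearson.
  replace (sigma_plus d (s + RtoC nu))
    with (sigma_plus d (s + RtoC nu) - sigma_s d s + sigma_s d s) by ring.
  rewrite <- eS; ring. }
rewrite nabla_xs_succ in eT, eS, hX, hY |- *.
unfold delta, psi; rewrite pearson.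
unfold xs in eG, eW, eV, eV'.
replace (z + 1 + RtoC ((nu - mu - 2) / 2)) with r in eT, hY by (unfold r; C_affine).
replace (z + 1 + RtoC (nu - mu - 2)) with (r - k + n) in eT
  by (unfold r, k, n; C_affine).
replace (r + k - n) with (z + 1) in core by (unfold r, k, n; C_affine).
replace (4 * n - 2 * k + 1)%R with (2 * nu - (mu + 1))%R in core
  by (unfold k, n; field).
replace (2 * k)%R with (mu + 1 + 1)%R in core by (unfold k; field).
replace (p + n) with (s + RtoC nu) in core by (unfold p, n; C_affine).
replace (p - n) with s in core by (unfold p, n; C_affine).
fold p in eG, eW, eS, hX |- *.
replace (z - RtoC (mu + 1) + RtoC (nu / 2)) with (r - k) in eG
  by (unfold r, k; C_affine).
replace (z + 1 + RtoC (nu / 2)) with (r + k) in eW by (unfold r, k; C_affine).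
replace (s + RtoC (mu + 2) + RtoC ((nu - (mu + 2)) / 2)) with (p + k) in eV
  by (unfold p, k; C_affine).
replace (z + 1 + RtoC ((nu - (mu + 2)) / 2)) with r in eV, eV'
  by (unfold r; C_affine).
replace (s + RtoC ((nu - (mu + 2)) / 2)) with (p - k) in eV'
  by (unfold p, k; C_affine).
(* What remains is algebra in the values of the functions involved. *)
revert core eT eG eW eV eV' hY nG nW.
clear. unfold psi.
generalize (lat_x (lat d) p) (lat_x (lat d) r) (lat_x (lat d) (r + k))
  (lat_x (lat d) (r - k)) (lat_x (lat d) (p + k)) (lat_x (lat d) (p - k))
  (nabla (xs (lat d) 1) p) (nabla (xs (lat d) 1) r)
  (sigma_s d (z + 1)) (sigma_s d s) (sigma_plus d (r - k + n))
  (sigma_plus d (s + nu)) (gamma (lat d) (mu + 1 + 1))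
  (kappa d (2 * nu - (mu + 1))) (tau_eta d (nu - mu - 2) (z + 1)) (rho_nu s)
  (gp P nu (mu + 1) s z) (gp P nu (mu + 1 + 1) s z) (gp P nu (mu + 2 + 1) s (z + 1))
  (gp P (nu - 1) (mu + 2) s (z + 1)) (gp P (nu - 1) (mu + 2) (s + 1) (z + 1)).
intros xp xr xrk xr' xpk xp' X Y sz ss sp sps g kap T rho E G W V V'
  core eT eG eW eV eV' hY nG nW.
rewrite <- eT in core.
assert (core' : X * (sz * g - T * (xp - xrk) - kap * (xp - xrk) * (xp - xr'))
  = - (sps * (xp' - xr) - ss * (xpk - xr))).
{ apply (Cmult_cancel_l Y); [exact hY|].
  etransitivity; [etransitivity; [|exact core]|]; ring. }
rewrite (Cdiv_expand (rho * sps) _ _ _ eV' nW).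
rewrite Cmult_comm in eV; rewrite (Cdiv_expand (ss * rho) _ _ _ eV nW).
rewrite (Cdiv_expand _ _ _ _ eG nG).
rewrite Cmult_comm in eW; rewrite 2!(Cdiv_expand _ _ _ _ eW nW).
transitivity (- rho * (- (sps * (xp' - xr) - ss * (xpk - xr))) / W);
  [field; exact nW | rewrite <- core'; field; exact nW].
Qed.

(** Any family phi satisfying the difference formulas may be used here: sums and
    integrals enter only through the vanishing of the combination. *)
Lemma adjoint_eq_of_combination (d : hdata) (nu mu : R) (lambda : C)
    (phi : R -> C -> C) (z : C) :
  lambda_star d nu mu lambda
    + kappa d (2 * nu - (mu + 1)) * gamma (lat d) (mu + 1) = 0 ->
  diff_formula (lat d) nu phi mu z ->
  diff_formula (lat d) nu phi mu (z + 1) ->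
  diff_formula (lat d) nu phi (mu + 1) (z + 1) ->
  - (sigma_s d (z + 1) * gamma (lat d) (mu + 1 + 1)) * phi (mu + 1 + 1)%R (z + 1)
    + tau_eta d (nu - mu - 2) (z + 1) * phi (mu + 1)%R z
    + kappa d (2 * nu - (mu + 1)) * phi mu z = 0 ->
  adjoint_eq d nu mu lambda (phi mu) z.
Proof.
unfold diff_formula; intros hl h0 h1 h2 hc; unfold adjoint_eq.
replace (delta (xs (lat d) (nu - mu - 1)) z)
  with (nabla (xs (lat d) (nu - (mu + 1))) (z + 1)).
2: { replace (nu - (mu + 1))%R with (nu - mu - 1)%R by ring.
     unfold nabla, delta; do 2 f_equal; ring. }
unfold delta at 1; rewrite h0, h1.
replace ((gamma (lat d) (mu + 1) * phi (mu + 1)%R (z + 1)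
          - gamma (lat d) (mu + 1) * phi (mu + 1)%R z)
         / nabla (xs (lat d) (nu - (mu + 1))) (z + 1))
  with (gamma (lat d) (mu + 1) * (gamma (lat d) (mu + 1 + 1) * phi (mu + 1 + 1)%R (z + 1))).
2: { rewrite <- h2; unfold nabla at 1; replace (z + 1 - 1) with z by ring.
     unfold Cdiv; ring. }
set (g1 := gamma (lat d) (mu + 1)) in *.
transitivity (- g1 * (- (sigma_s d (z + 1) * gamma (lat d) (mu + 1 + 1))
                        * phi (mu + 1 + 1)%R (z + 1)
      + tau_eta d (nu - mu - 2) (z + 1) * phi (mu + 1)%R z
      + kappa d (2 * nu - (mu + 1)) * phi mu z)
    + (lambda_star d nu mu lambda + kappa d (2 * nu - (mu + 1)) * g1) * phi mu z);
  [ring | rewrite hc, hl; ring].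
Qed.

(** * Sums and contour integrals *)

Lemma csum_lin3 (u v w : C) (f g h : nat -> C) (N : nat) :
  csum (fun j => u * f j + v * g j + w * h j) N
  = u * csum f N + v * csum g N + w * csum h N.
Proof. induction N as [|N IH]; cbn; [|rewrite IH]; ring. Qed.

Lemma csum_ext (f g : nat -> C) (N : nat) :
  (forall j, (j < N)%nat -> f j = g j) -> csum f N = csum g N.
Proof.
induction N as [|N IH]; intro H; cbn; [reflexivity|].
rewrite IH, (H N) by auto; reflexivity.
Qed.

Lemma csum_delta (f : C -> C) (a : C) (N : nat) :
  csum (fun j => delta f (a + RtoC (INR j))) N = f (a + RtoC (INR N)) - f a.
Proof.
induction N as [|N IH].
- cbn; rewrite Cplus_0_r; ring.
- change (csum (fun j => delta f (a + RtoC (INR j))) N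
          + delta f (a + RtoC (INR N)) = f (a + RtoC (INR (S N))) - f a).
  rewrite IH, S_INR, RtoC_plus; unfold delta; rewrite Cplus_assoc; ring.
Qed.

(** The integral of complex functions is defined for the real vector space C, so
    linearity over C is obtained from the real and imaginary parts. *)
Lemma is_RInt_Cmult (f : R -> C) (ta tb : R) (w l : C) :
  is_RInt (V := C_R_NormedModule) f ta tb l ->
  is_RInt (V := C_R_NormedModule) (fun t => w * f t) ta tb (w * l).
Proof.
intro H.
pose proof (is_RInt_fct_extend_fst (U:=R_NormedModule) (V:=R_NormedModule) _ _ _ _ H) as H1.
pose proof (is_RInt_fct_extend_snd (U:=R_NormedModule) (V:=R_NormedModule) _ _ _ _ H) as H2.
apply (is_RInt_fct_extend_pair (U:=R_NormedModule) (V:=R_NormedModule)).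
- apply (is_RInt_minus (V := R_NormedModule)); apply (is_RInt_scal (V := R_NormedModule)); assumption.
- apply (is_RInt_plus (V := R_NormedModule)); apply (is_RInt_scal (V := R_NormedModule)); assumption.
Qed.

Lemma is_cint_lin3 (c : R -> C) (ta tb : R) (u v w : C) (f g h : C -> C) :
  ex_cint c ta tb f -> ex_cint c ta tb g -> ex_cint c ta tb h ->
  is_RInt (V := C_R_NormedModule)
    (fun t => (u * f (c t) + v * g (c t) + w * h (c t)) * path_derive c t) ta tb
    (u * cint c ta tb f + v * cint c ta tb g + w * cint c ta tb h).
Proof.
intros Hf Hg Hh.
apply (RInt_correct (V := C_R_CompleteNormedModule)) in Hf, Hg, Hh.
apply (is_RInt_Cmult _ _ _ u) in Hf.
apply (is_RInt_Cmult _ _ _ v) in Hg.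
apply (is_RInt_Cmult _ _ _ w) in Hh.
refine (is_RInt_ext _ _ _ _ _ _
  (is_RInt_plus _ _ _ _ _ _ (is_RInt_plus _ _ _ _ _ _ Hf Hg) Hh)).
intros t _.
match goal with |- ?l = ?r => change (@eq C l r) end.
change (u * (f (c t) * path_derive c t) + v * (g (c t) * path_derive c t)
  + w * (h (c t) * path_derive c t)
  = (u * f (c t) + v * g (c t) + w * h (c t)) * path_derive c t); ring.
Qed.

Lemma contour_lt (c : R -> C) (ta tb : R) : contour c ta tb -> (ta < tb)%R.
Proof. induction 1; lra. Qed.

(* D0, D are the sets on which rho, rho_nu are defined; Z is the region of the
   z-plane in which the equation is considered (both may be the whole plane). *)
Theorem theorem4p1
  (d : hdata) (hL : lattice_ok (lat d)) (P : genpow (lat d))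
  (nu mu : R) (lambda : C)
  (D0 D : C -> Prop) (rho rho_nu : C -> C) (Z : C -> Prop)
  (hrho : forall z : C, D0 z -> D0 (z + 1) -> nabla (xs (lat d) 1) z <> 0 ->
     delta (fun w => sigma_s d w * rho w) z / nabla (xs (lat d) 1) z
     = tau_s d z * rho z)
  (hrho_nu : forall z : C, D z -> D (z + 1) ->
     nabla (xs (lat d) (nu + 1)) z <> 0 ->
     delta (fun w => sigma_s d w * rho_nu w) z / nabla (xs (lat d) (nu + 1)) z
     = tau_eta d nu z * rho_nu z)
  (hmunu : lambda_star d nu mu lambda
           + kappa d (2 * nu - (mu + 1)) * gamma (lat d) (mu + 1) = 0) :
  (forall (a b : C) (N : nat),
     snd a = snd b -> b - a = RtoC (INR N) ->
     let pts := sum_pts a N in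
     let phi := phi_sum P rho_nu nu a N in
     let ok := phi_sum_ok P nu a N in
     (forall s : C, pts s ->
        D s /\ D (s + 1) /\ nabla (xs (lat d) (nu + 1)) s <> 0) ->
     (forall (m : R) (z : C), m = mu \/ m = (mu + 1)%R -> Z z ->
        diff_formula_ok (lat d) nu ok m z ->
        diff_formula (lat d) nu phi m z) ->
     (forall z : C, Z z -> psi_ok P nu mu pts z ->
        psi d P rho_nu nu mu a z = psi d P rho_nu nu mu b z) ->
     forall z : C, Z z -> Z (z + 1) -> admissible P nu mu pts ok z ->
       adjoint_eq d nu mu lambda (phi mu) z)
  /\
  (forall (c : R -> C) (ta tb : R),
     contour c ta tb ->
     let pts := contour_pts c ta tb in
     let phi := phi_int P rho_nu nu c ta tb in
     let ok := phi_int_ok P rho_nu nu c ta tb in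
     (forall s : C, pts s ->
        D s /\ D (s + 1) /\ nabla (xs (lat d) (nu + 1)) s <> 0) ->
     (forall (m : R) (z : C), m = mu \/ m = (mu + 1)%R -> Z z ->
        diff_formula_ok (lat d) nu ok m z ->
        diff_formula (lat d) nu phi m z) ->
     (forall z : C, Z z -> psi_ok P nu mu pts z ->
        ex_cint c ta tb (delta (fun s => psi d P rho_nu nu mu s z)) ->
        cint c ta tb (delta (fun s => psi d P rho_nu nu mu s z)) = 0) ->
     forall z : C, Z z -> Z (z + 1) -> admissible P nu mu pts ok z ->
       adjoint_eq d nu mu lambda (phi mu) z).
Proof.
assert (pointwise : forall (pts : C -> Prop) (z s : C),
  (forall s0, pts s0 -> D s0 /\ D (s0 + 1) /\ nabla (xs (lat d) (nu + 1)) s0 <> 0) ->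
  nabla (xs (lat d) (nu - (mu + 1))) (z + 1) <> 0 ->
  kernel_ok P nu mu pts z -> kernel_ok P nu (mu + 1) pts z ->
  kernel_ok P nu (mu + 1 + 1) pts (z + 1) -> psi_ok P nu mu pts z ->
  pts s ->
  delta (fun w => psi d P rho_nu nu mu w z) s
  = - (sigma_s d (z + 1) * gamma (lat d) (mu + 1 + 1))
      * kernel P rho_nu nu (mu + 1 + 1) (z + 1) s
    + tau_eta d (nu - mu - 2) (z + 1) * kernel P rho_nu nu (mu + 1) z s
    + kappa d (2 * nu - (mu + 1)) * kernel P rho_nu nu mu z s).
{ intros pts z s hD hY k0 k1 k2 hpsi hs.
  destruct (hD s hs) as (D1 & D2 & hX), (hpsi s hs) as (p1 & p2).
  apply delta_psi_kernel; auto. }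
split.
- intros a b N _ hab pts phi ok hD hdiff hpsi z Zz Zz1 (a0 & a1 & a2 & a3).
  apply adjoint_eq_of_combination; auto.
  destruct a0 as (_ & k0 & _), a2 as (hY & _ & k1 & k2).
  replace (z + 1 - 1) with z in k1 by ring.
  unfold phi, phi_sum; rewrite <- csum_lin3.
  erewrite csum_ext.
  2: { intros j hj; symmetry; apply (pointwise pts); auto.
       exists j; auto. }
  rewrite (csum_delta (fun w => psi d P rho_nu nu mu w z)), <- hab.
  rewrite (hpsi z Zz a3); replace (a + (b - a)) with b by ring; ring.
- intros c ta tb hc pts phi ok hD hdiff hpsi z Zz Zz1 (a0 & a1 & a2 & a3).
  apply adjoint_eq_of_combination; auto.
  destruct a0 as (_ & (k0 & i0) & _), a2 as (hY & _ & (k1 & i1) & (k2 & i2)).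
  replace (z + 1 - 1) with z in k1, i1 by ring.
  assert (int : is_RInt (V := C_R_NormedModule)
    (fun t => delta (fun w => psi d P rho_nu nu mu w z) (c t) * path_derive c t) ta tb
    (- (sigma_s d (z + 1) * gamma (lat d) (mu + 1 + 1)) * phi (mu + 1 + 1)%R (z + 1)
      + tau_eta d (nu - mu - 2) (z + 1) * phi (mu + 1)%R z
      + kappa d (2 * nu - (mu + 1)) * phi mu z)).
  { refine (is_RInt_ext _ _ _ _ _ _ (is_cint_lin3 c ta tb _ _ _ _ _ _ i2 i1 i0)).
    intros t ht; cbv beta.
    pose proof (contour_lt _ _ _ hc).
    rewrite Rmin_left, Rmax_right in ht by lra.
    rewrite <- (pointwise pts); auto.
    exists t; split; [lra | reflexivity]. }
  rewrite <- (hpsi z Zz a3 (ex_intro _ _ int)).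
  symmetry; exact (is_RInt_unique (V := C_R_CompleteNormedModule) _ _ _ _ int).
Qed.
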